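(* Let $(E,\mathcal E,\mu)$ be a measure space. (a) $(\widetilde{\mathcal E},d_\mu)$ is separable if and only if there exists a filtration $\mathcal F=(\mathcal F_n)_{n\in\mathbb N}$, with $|\mathcal F_n|$ finite for each $n\in\mathbb N$, such that $\mu$ is approximable on $\mathcal E$ with respect to $\mathcal F$. (b) $(\widetilde{\mathcal E},d_\mu)$ is compact if and only if there exists a filtration $\mathcal F=(\mathcal F_n)_{n\in\mathbb N}$, with $|\mathcal F_n|$ finite for each $n\in\mathbb N$, such that $\mu$ is uniformly approximable on $\mathcal E$ with respect to $\mathcal F$.
   Context: The measure $\mu$ is arbitrary (possibly infinite). For $A\in\mathcal E$ let $[A]=\{B\in\mathcal E:\mu(A\Delta B)=0\}$, where $\Delta$ is symmetric difference, and $\widetilde{\mathcal E}=\{[A]:A\in\mathcal E\}$. The metric, possibly taking the value $\infty$, is $d_\mu([A],[B])=\mu(A\Delta B)^{1/2}$ on $\widetilde{\mathcal E}$, and $\widetilde{\mathcal E}$ carries the topology generated by $d_\mu$. A filtration is a sequence $\mathcal F=(\mathcal F_n)_{n\in\mathbb N}$ of $\sigma$-algebras on $E$ with $\mathcal F_n\subseteq\mathcal E$ and $\mathcal F_n\subseteq\mathcal F_{n+1}$ for all $n$. The measure $\mu$ is approximable on $\mathcal E$ with respect to $\mathcal F$ if for each $A\in\mathcal E$ and each $\epsilon>0$ there exist $n_\epsilon\in\mathbb N$ and $A'\in\mathcal F_{n_\epsilon}$ such that $\mu(A\Delta A')<\epsilon$. It is uniformly approximable on $\mathcal E$ with respect to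 $\mathcal F$ if for each $\epsilon>0$ there exists $n_\epsilon\in\mathbb N$ such that for every $A\in\mathcal E$ there exists $A'\in\mathcal F_{n_\epsilon}$ with $\mu(A\Delta A')<\epsilon$. *)

(* Defs.v *)
From HB Require Import structures.
From mathcomp Require Import all_boot all_order all_algebra.
From mathcomp Require Import all_classical all_reals all_analysis.

Set Implicit Arguments.
Unset Strict Implicit.
Unset Printing Implicit Defensive.

Import Order.TTheory GRing.Theory Num.Theory.

Local Open Scope classical_set_scope.
Local Open Scope ring_scope.
Local Open Scope ereal_scope.

Section measure_algebra.
Context d (T : measurableType d) (R : realType).
Variable mu : {measure set T -> \bar R}.

(* [A] *)
Definition mclass (A : set T) : set (set T) :=
  [set B | measurable B /\ mu (A `+` B) = 0].

Definition mclasses : Type := set_type (mclass @` measurable).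

HB.instance Definition _ := Choice.on mclasses.

Definition mclass_of (A : set T) (mA : measurable A) : mclasses :=
  SigSub (mem_set (imageP mclass mA)).

(* A choice of representative; by [dmuE] the distance does not depend on it. *)
Definition mrepr (X : mclasses) : set T := xget set0 (val X).

Definition dmu (X Y : mclasses) : \bar R :=
  mu (mrepr X `+` mrepr Y) `^ (2^-1)%R.

Lemma measurable_setY (A B : set T) :
  measurable A -> measurable B -> measurable (A `+` B).
Proof. by move=> mA mB; apply: measurableU; exact: measurableD. Qed.

Lemma setY_sub (A B C : set T) : A `+` C `<=` (A `+` B) `|` (B `+` C).
Proof.
move=> x /= [[xA xC]|[xC xA]]; have [xB|xB] := pselect (B x).
- by right; left.
- by left; left.
- by left; right.
- by right; right.
Qed.

Lemma mu_setY_triangle (A B C : set T) :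
  measurable A -> measurable B -> measurable C ->
  mu (A `+` C) <= mu (A `+` B) + mu (B `+` C).
Proof.
move=> mA mB mC.
have mAB := measurable_setY mA mB; have mBC := measurable_setY mB mC.
apply: (@le_trans _ _ (mu ((A `+` B) `|` (B `+` C)))).
  apply: le_measure; rewrite ?inE; last exact: setY_sub.
    exact: measurable_setY.
  exact: measurableU.
exact: measureU2.
Qed.

Lemma mreprP (X : mclasses) :
  measurable (mrepr X) /\ val X = mclass (mrepr X).
Proof.
case: X => S hS; rewrite /mrepr /=.
have [A mA AS] := set_mem hS.
have SA : S A by rewrite -AS; split=> //; rewrite setYK measure0.
have := xgetPex set0 (ex_intro _ A SA); set B := xget _ _.
rewrite -AS => -[mB AB0]; split=> //.
apply/seteqP; split=> C [mC C0]; split=> //; apply/eqP;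
  rewrite eq_le measure_ge0 andbT.
- by rewrite (le_trans (mu_setY_triangle mB mA mC))// C0 setYC AB0 adde0.
- by rewrite (le_trans (mu_setY_triangle mA mB mC))// C0 AB0 adde0.
Qed.

Lemma mrepr_mclass (A : set T) (mA : measurable A) :
  mu (A `+` mrepr (mclass_of mA)) = 0.
Proof.
have [mB AB] := mreprP (mclass_of mA).
suff: mclass A (mrepr (mclass_of mA)) by case.
by rewrite -[mclass A]/(val (mclass_of mA)) AB; split=> //;
  rewrite setYK measure0.
Qed.

Lemma dmuE (A B : set T) (mA : measurable A) (mB : measurable B) :
  dmu (mclass_of mA) (mclass_of mB) = mu (A `+` B) `^ (2^-1)%R.
Proof.
rewrite /dmu; congr (_ `^ _).
have [mA' _] := mreprP (mclass_of mA); have [mB' _] := mreprP (mclass_of mB).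
have A0 := mrepr_mclass mA; have B0 := mrepr_mclass mB.
apply/eqP; rewrite eq_le; apply/andP; split.
- apply: (le_trans (mu_setY_triangle mA' mA mB')).
  rewrite [X in mu X + _]setYC A0 add0e.
  by rewrite (le_trans (mu_setY_triangle mA mB mB'))// B0 adde0.
- apply: (le_trans (mu_setY_triangle mA mA' mB)); rewrite A0 add0e.
  apply: (le_trans (mu_setY_triangle mA' mB' mB)).
  by rewrite [X in _ + mu X]setYC B0 adde0.
Qed.

Lemma dmu_ge0 (X Y : mclasses) : 0 <= dmu X Y.
Proof. exact: poweR_ge0. Qed.

Lemma dmuxx (X : mclasses) : dmu X X = 0.
Proof. by rewrite /dmu setYK measure0 poweR0r// invr_eq0 pnatr_eq0. Qed.

Lemma dmu_eq0 (X Y : mclasses) : dmu X Y = 0 -> X = Y.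
Proof.
move=> /(poweR_eq0_eq0 (measure_ge0 _ _)) XY0; apply: val_inj => /=.
have [mX ->] := mreprP X; have [mY ->] := mreprP Y.
apply/seteqP; split=> C [mC C0]; split=> //; apply/eqP;
  rewrite eq_le measure_ge0 andbT.
- by rewrite (le_trans (mu_setY_triangle mY mX mC))// C0 setYC XY0 adde0.
- by rewrite (le_trans (mu_setY_triangle mX mY mC))// C0 XY0 adde0.
Qed.

Lemma dmu_sym (X Y : mclasses) : dmu X Y = dmu Y X.
Proof. by rewrite /dmu setYC. Qed.

Lemma dmu_triangle (X Y Z : mclasses) : dmu X Z <= dmu X Y + dmu Y Z.
Proof.
have [mX _] := mreprP X; have [mY _] := mreprP Y; have [mZ _] := mreprP Z.
rewrite /dmu !poweR12_sqrt//.
set a := mu (_ `+` mrepr Y); set b := mu (mrepr Y `+` _).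
have a0 : 0 <= a by exact: measure_ge0.
have b0 : 0 <= b by exact: measure_ge0.
apply: (@le_trans _ _ (sqrte (a + b))).
  by rewrite lee_sqrt ?adde_ge0//; exact: mu_setY_triangle.
case: a b a0 b0 => [a||] [b||]//=; rewrite ?leey// !lee_fin => a0 b0.
rewrite -ler_sqr ?nnegrE ?addr_ge0 ?sqrtr_ge0//.
rewrite sqr_sqrtr ?addr_ge0// sqrrD !sqr_sqrtr//.
by rewrite lerD2r lerDl mulrn_wge0// mulr_ge0// sqrtr_ge0.
Qed.

Definition dmu_ball (X : mclasses) (e : R) : set mclasses :=
  [set Y | dmu X Y < e%:E].

Lemma dmu_ball_center X (e : R) : (0 < e)%R -> dmu_ball X e X.
Proof. by move=> e0; rewrite /dmu_ball /= dmuxx lte_fin. Qed.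

Lemma dmu_ball_sym X Y (e : R) : dmu_ball X e Y -> dmu_ball Y e X.
Proof. by rewrite /dmu_ball /= dmu_sym. Qed.

Lemma dmu_ball_triangle X Y Z (e1 e2 : R) :
  dmu_ball X e1 Y -> dmu_ball Y e2 Z -> dmu_ball X (e1 + e2)%R Z.
Proof.
rewrite /dmu_ball /= EFinD => XY YZ.
by rewrite (le_lt_trans (dmu_triangle X Y Z))// lteD.
Qed.

HB.instance Definition _ := hasNbhs.Build mclasses
  (nbhs_ (entourage_ dmu_ball)).

(* The distance may be infinite: the interface only asks for balls of finite
   radius. *)
HB.instance Definition _ := Nbhs_isPseudoMetric.Build R mclasses
  erefl dmu_ball_center dmu_ball_sym dmu_ball_triangle erefl.

Lemma ball_dmuE (X Y : mclasses) (e : R) : ball X e Y = (dmu X Y < e%:E).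
Proof. by []. Qed.

Definition filtration (F : nat -> set (set T)) : Prop :=
  [/\ forall n, sigma_algebra [set: T] (F n),
      forall n, F n `<=` measurable &
      forall n, F n `<=` F n.+1].

Definition approximable (F : nat -> set (set T)) : Prop :=
  forall A, measurable A -> forall e : R, (0 < e)%R ->
    exists n, exists2 A', F n A' & mu (A `+` A') < e%:E.

Definition uniformly_approximable (F : nat -> set (set T)) : Prop :=
  forall e : R, (0 < e)%R -> exists n, forall A, measurable A ->
    exists2 A', F n A' & mu (A `+` A') < e%:E.

End measure_algebra.

Definition separable_space (X : topologicalType) : Prop :=
  exists2 S : set X, countable S & dense S.

(* Main.v *)
Require Import Defs.
From HB Require Import structures.
From mathcomp Require Import all_boot all_order all_algebra.
From mathcomp Require Import all_classical all_reals all_analysis.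
From mathcomp Require Import finmap.

Local Open Scope classical_set_scope.
Local Open Scope ring_scope.

(* If the space is separable (resp. totally bounded), the sigma-algebras
   generated by growing finite families of representatives of a dense sequence
   (resp. of 1/n-nets) are finite and approximate.  Conversely, the classes of
   the members of the F_n are countable and dense; under uniform approximation
   they contain finite nets at every scale, so compactness follows from
   completeness, which is the Borel-Cantelli argument: if the measures of the
   sets A_k + A_(k+1) are summable, then A_n tends to limsup A. *)

Set Implicit Arguments.
Unset Strict Implicit.
Unset Printing Implicit Defensive.

Import Order.TTheory GRing.Theory Num.Theory.

(* Every set generated by [G] is a union of fibres of the map sending a point
   to the set of members of [G] containing it, which has finite range. *)
Lemma finite_sigma_algebra_generated (T : Type) (G : set (set T)) :
  finite_set G -> finite_set <<s G >>.
Proof.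
move=> /(@finite_fsetP (set T))[X ->{G}].
pose phi x : {ffun X -> bool} := [ffun A : X => x \in fsval A].
pose H (P : {set {ffun X -> bool}}) := [set x : T | phi x \in P].
apply: (@sub_finite_set _ _ (range H)); last exact: finite_image.
apply: smallest_sub.
  split.
  - by exists finset.set0 => //; apply/seteqP; split=> x; rewrite /H /= inE.
  - move=> _ [P _ <-]; exists (~: P)%SET => //.
    apply/seteqP; split=> x; rewrite /H /= inE; first by move/negP.
    by move=> [_ /negP].
  - move=> B HB.
    (* [H] need not be injective, so every [P] that represents some [B n] is collected. *)
    exists [set p | `[< exists n P, H P = B n /\ p \in P >]]%SET => //.
    apply/seteqP; split=> x; rewrite /H /= inE.
      by move=> /asboolP[n [P [PB xP]]]; exists n => //; rewrite -PB.
    move=> [n _ Bnx]; apply/asboolP; have [P _ PB] := HB n.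
    by exists n, P; split=> //; move: Bnx; rewrite -PB.
move=> A /= AX; exists [set p : {ffun X -> bool} | p [` AX]%fset]%SET => //.
by apply/seteqP; split=> x; rewrite /H /= inE ffunE /=;
  [move/set_mem | move/mem_set].
Qed.

(** * Filtrations generated by finite families *)

Section generated_filtration.
Context d (T : measurableType d) (G : nat -> set (set T)).

Definition generated_filtration n := <<s \bigcup_(k in `I_n.+1) G k >>.

Lemma filtration_generated :
  (forall n, G n `<=` measurable) -> filtration generated_filtration.
Proof.
move=> mG; split=> n.
- exact: smallest_sigma_algebra.
- apply: smallest_sub; first exact: sigma_algebra_measurable.
  by move=> A [k _ /mG].
- by apply: sub_sigma_algebra2; apply: bigcup_subset => k /=; apply: leqW.
Qed.

Lemma finite_generated_filtration :
  (forall n, finite_set (G n)) -> forall n, finite_set (generated_filtration n).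
Proof.
move=> finG n; apply: finite_sigma_algebra_generated.
by apply: bigcup_finite => //; exact: finite_II.
Qed.

Lemma sub_generated_filtration n : G n `<=` generated_filtration n.
Proof. by move=> A GA; apply: sub_sigma_algebra; exists n => /=. Qed.

End generated_filtration.

Lemma ultra_bigcup_fset (T : Type) (I : choiceType) (D : {fset I})
    (f : I -> set T) (F : set_system T) :
  UltraFilter F -> (forall x, exists2 i, i \in D & f i x) ->
  exists2 i, i \in D & F (f i).
Proof.
move=> UF cov; apply: contrapT => noF.
have : F (\bigcap_(i in [set` D]) ~` f i).
  apply: filter_bigI => i iD.
  by have [Ffi|//] := in_ultra_setVsetC (f i) UF; case: noF; exists i.
move=> /filter_ex[x fx]; have [i iD fix_] := cov x.
exact: fx fix_.
Qed.

Section measure_algebra_metric.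
Context d (T : measurableType d) (R : realType).
Variable mu : {measure set T -> \bar R}.

Local Open Scope ereal_scope.

(* [compact_cover] is stated for pointed spaces only. *)
HB.instance Definition _ :=
  isPointed.Build (mclasses mu) (mclass_of mu measurable0).

Lemma mclass_of_mrepr (X : mclasses mu) : mclass_of mu (mreprP X).1 = X.
Proof. by apply: val_inj => /=; rewrite -(mreprP X).2. Qed.

(** Turns balls into measure estimates; the square undoes the exponent 1/2 in [dmu]. *)
Lemma ball_mclass_of (A : set T) (mA : measurable A) (X : mclasses mu) (e : R) :
  (0 < e)%R ->
  ball (mclass_of mu mA) e X <-> mu (A `+` mrepr X) < (e ^+ 2)%:E.
Proof.
move=> e0; rewrite ball_dmuE -{1}(mclass_of_mrepr X) dmuE poweR12_sqrt//.
have : 0 <= mu (A `+` mrepr X) by [].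
case: (mu _) => [x||]//=.
rewrite !lte_fin lee_fin => x0.
rewrite -(@ltr_pXn2r _ 2)// ?nnegrE ?sqrtr_ge0 ?ltW//.
by rewrite sqr_sqrtr.
Qed.

(** * Convergence to the limsup *)

Lemma measurable_lim_sup_set (A : (set T)^nat) :
  (forall n, measurable (A n)) -> measurable (lim_sup_set A).
Proof.
by move=> mA; apply: bigcap_measurable => // k _; exact: bigcup_measurable.
Qed.

(* [A n] and [lim_sup_set A] agree at every point where the sequence is
   constant from rank [n] on. *)
Lemma setY_lim_sup_set_sub (A : (set T)^nat) n :
  A n `+` lim_sup_set A `<=` \bigcup_(k in ~` `I_n) (A k `+` A k.+1).
Proof.
move=> x; apply: contraPP => xcst.
have cst k : A (n + k)%N x <-> A n x.
  elim: k => [|k <-]; first by rewrite addn0.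
  have : ~ (A (n + k)%N `+` A (n + k).+1) x.
    move=> Ax; apply: xcst; exists (n + k)%N => //=.
    by apply/negP; rewrite -leqNgt leq_addr.
  rewrite addnS /setY /setD /= => /not_orP[h1 h2].
  split=> Ax; apply: contrapT => nAx; first by apply: h2.
  by apply: h1.
case=> -[Ax nAx]; apply: nAx.
- move=> m _; exists (n + m)%N; first by rewrite /= leq_addl.
  exact/cst.
- by have [k /= nk Akx] := Ax n I; apply/(cst (k - n)%N); rewrite subnKC.
Qed.

(** By the previous inclusion, the measure is squeezed between 0 and the tail of a convergent
    series. *)
Lemma measure_setY_lim_sup_set (A : (set T)^nat) :
  (forall n, measurable (A n)) ->
  \sum_(k <oo) mu (A k `+` A k.+1) < +oo ->
  mu (A n `+` lim_sup_set A) @[n --> \oo] --> 0.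
Proof.
move=> mA sumA.
apply: (@squeeze_cvge _ _ _ _ (cst 0) _
  (fun n => \sum_(n <= k <oo) mu (A k `+` A k.+1))).
- apply: nearW => n; rewrite measure_ge0 /=.
  apply: measure_sigma_subadditive_tail.
  + by move=> k; exact: measurable_setY.
  + by apply: measurable_setY => //; exact: measurable_lim_sup_set.
  + exact: setY_lim_sup_set_sub.
- exact: cvg_cst.
- exact: nneseries_tail_cvg.
Qed.

(** * From topology to filtrations *)

Lemma dense_approximation (S : set (mclasses mu)) (A : set T) (e : R) :
  dense S -> measurable A -> (0 < e)%R ->
  exists2 X, S X & mu (A `+` mrepr X) < e%:E.
Proof.
move=> dS mA e0; have se0 : (0 < Num.sqrt e)%R by rewrite sqrtr_gt0.
have [||X [/interior_subset/(ball_mclass_of mA _ se0) AX SX]] :=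
  dS (ball (mclass_of mu mA) (Num.sqrt e))^°.
- by exists (mclass_of mu mA); exact: nbhsx_ballx.
- exact: open_interior.
- by exists X => //; rewrite sqr_sqrtr// ltW in AX.
Qed.

Lemma separable_approximable : separable_space (mclasses mu) ->
  exists F : nat -> set (set T),
    [/\ filtration F, forall n, finite_set (F n) & approximable mu F].
Proof.
move=> [S /pcard_injP[g] /= ginj dS].
(* As [g] is injective on [S], each [G n] has at most one element; it is empty when [g] misses
   [n]. *)
pose G n := @mrepr _ _ _ mu @` [set X | S X /\ g X = n].
exists (generated_filtration G); split.
- by apply: filtration_generated => n _ [X _ <-]; have [] := mreprP X.
- apply: finite_generated_filtration => n; apply: finite_image.
  have [[X [SX gX]]|noX] := pselect (exists X, S X /\ g X = n).
    apply: (@sub_finite_set _ _ [set X]) => // Y [SY gY].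
    by apply: ginj; rewrite ?gX//; exact: mem_set.
  by rewrite (_ : mkset _ = set0)// -subset0 => X SX; apply: noX; exists X.
- move=> A mA e e0; have [X SX AX] := dense_approximation dS mA e0.
  exists (g X), (mrepr X) => //.
  by apply: sub_generated_filtration; exists X.
Qed.

(** A single finite net serves all sets at once, so the stage depends on [e] alone. *)
Lemma compact_uniformly_approximable : compact [set: mclasses mu] ->
  exists F : nat -> set (set T),
    [/\ filtration F, forall n, finite_set (F n) & uniformly_approximable mu F].
Proof.
rewrite compact_cover => cT.
have net n : exists D : {fset mclasses mu},
    forall X, exists2 Y, Y \in D & ball Y n.+1%:R^-1 X.
  have [||D _ cD] := cT (mclasses mu) setT
    (fun X => (ball X (n.+1%:R^-1 : R))^°).
  - by move=> X _; exact: open_interior.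
  - move=> X _; exists X => //; apply: nbhsx_ballx.
    by rewrite invr_gt0.
  - by exists D => X; have [Y YD /interior_subset] := cD X I; exists Y.
have {net}[D netD] := choice net.
exists (generated_filtration (fun n => @mrepr _ _ _ mu @` [set` D n])); split.
- by apply: filtration_generated => n _ [X _ <-]; have [] := mreprP X.
- by apply: finite_generated_filtration => n; apply: finite_image.
- move=> e e0; have se0 : (0 < Num.sqrt e)%R by rewrite sqrtr_gt0.
  have [n _ ne] : \forall n \near \oo, (n.+1%:R^-1 < Num.sqrt e)%R.
    exact: near_infty_natSinv_lt (PosNum se0).
  exists n => A mA; have [Y YD YA] := netD n (mclass_of mu mA).
  exists (mrepr Y); first by apply: sub_generated_filtration; exists Y.
  have := le_ball (ltW (ne n (leqnn n))) YA.
  by move/ball_sym/(ball_mclass_of mA _ se0); rewrite sqr_sqrtr// ltW.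
Qed.

(** * From filtrations to topology *)

Lemma approximable_separable (F : nat -> set (set T)) :
  filtration F -> (forall n, finite_set (F n)) -> approximable mu F ->
  separable_space (mclasses mu).
Proof.
move=> [_ mF _] finF appF.
(* [cl] is total so that images can be taken; members of the [F n] are measurable and never reach
   the default. *)
pose cl A := if pselect (measurable A) is left mA then mclass_of mu mA
             else mclass_of mu measurable0.
exists (cl @` \bigcup_n F n).
  apply: (@sub_countable _ _ _ (\bigcup_n F n)); first exact: card_image_le.
  by apply: bigcup_countable => // n _; exact: finite_set_countable.
move=> U [X UX] oU.
have /nbhs_ballP[e /= e0 eU] : nbhs X U by exact: open_nbhs_nbhs.
have [n [A FA XA]] := appF _ (mreprP X).1 _ (exprn_gt0 2 e0).
have mA := mF _ _ FA.
exists (cl A); split; last by exists A => //; exists n.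
apply: eU; apply: ball_sym; rewrite /cl; case: pselect => // mA'.
by apply/(ball_mclass_of mA' _ e0); rewrite setYC.
Qed.

(* An ultrafilter contains, for each [k], a ball of radius [2 ^- k.+2] centred
   in the finite net; the centres are summably close to one another, and the
   class of their limsup is a limit of the ultrafilter. *)
Lemma uniformly_approximable_compact (F : nat -> set (set T)) :
  filtration F -> (forall n, finite_set (F n)) -> uniformly_approximable mu F ->
  compact [set: mclasses mu].
Proof.
move=> [_ mF _] finF appF; rewrite compact_ultra /= => U UU _.
(* Chosen so that [s k + s k] is the general term of a series of sum 1. *)
pose s (k : nat) : R := (1 / (2 ^ k.+2)%:R)%R.
have s0 k : (0 < s k)%R by rewrite divr_gt0// ltr0n expn_gt0.
have sS k : (s k.+1 <= s k)%R.
  by rewrite ler_pM2l// lef_pV2 ?posrE ?ltr0n ?expn_gt0// ler_nat leq_exp2l.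
have s2 k : (s k + s k = 1 / (2 ^ k.+1)%:R)%R.
  by rewrite /s [RHS]splitr expnS mulnC natrM invfM mulrA.
have center k : exists A, measurable A /\
    U [set Y : mclasses mu | mu (A `+` mrepr Y) < (s k)%:E].
  have [n appn] := appF _ (s0 k).
  have /finite_fsetP[D FD] := finF n.
  have [x|A AD UA] := @ultra_bigcup_fset _ _ D
      (fun A => [set Y : mclasses mu | mu (A `+` mrepr Y) < (s k)%:E]) _ UU.
    have [A FA xA] := appn _ (mreprP x).1.
    by exists A; [move: FA; rewrite FD|rewrite /= setYC].
  by exists A; split=> //; apply: (mF n); rewrite FD.
have {center}[A /all_and2[mA UA]] := choice center.
have mL : measurable (lim_sup_set A) by exact: measurable_lim_sup_set.
have cvgA : mu (A n `+` lim_sup_set A) @[n --> \oo] --> 0.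
  apply: measure_setY_lim_sup_set => //.
  apply: (@le_lt_trans _ _ (\sum_(k <oo) (1 / (2 ^ k.+1)%:R)%:E)).
    apply: lee_nneseries => // k _.
    (* Two members of [U] meet; a common point [Y] links [A k] to [A k.+1]. *)
    have [Y [YA YA']] := filter_ex (filterI (UA k) (UA k.+1)).
    apply: (le_trans (mu_setY_triangle mu (mA k) (mreprP Y).1 (mA k.+1))).
    rewrite -s2 EFinD leeD ?ltW// setYC (lt_le_trans YA')//.
    by rewrite lee_fin.
  by apply: le_lt_trans (epsilon_trick0 _ _) _; rewrite ?ltry.
exists (mclass_of mu mL); split=> //=; apply/cvg_ballP => e e0.
have e20 : (0 < e ^+ 2 / 2)%R by rewrite divr_gt0// exprn_gt0.
have : \forall n \near \oo, mu (A n `+` lim_sup_set A) < (e ^+ 2 / 2)%:E /\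
    (s n < e ^+ 2 / 2)%R.
  near=> n; split.
    near: n; apply: (cvgA [set x | x < _]); apply: open_ereal_lt'.
    by rewrite lte_fin.
  apply: (@le_lt_trans _ _ (1 / 2 ^+ n)%R).
    rewrite /s -natrX ler_pM2l// lef_pV2 ?posrE ?ltr0n ?expn_gt0//.
    by rewrite ler_nat leq_exp2l// -addn2 leq_addr.
  by near: n; exact: near_infty_natSinv_expn_lt (PosNum e20).
(* One such [n] suffices: the member [UA n] of [U] lies in the ball of radius [e] around the
   limit. *)
move=> [n _ /(_ n (leqnn n))[/= LA sn]].
apply: filterS (UA n) => Y AY; apply/(ball_mclass_of mL _ e0).
apply: (le_lt_trans (mu_setY_triangle mu mL (mA n) (mreprP Y).1)).
rewrite (splitr (e ^+ 2)) EFinD setYC lteD//.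
by rewrite (lt_trans AY)// lte_fin.
Unshelve. all: by end_near. Qed.

End measure_algebra_metric.

Theorem corollary3p1 (R : realType) (d : measure_display)
    (E : measurableType d) (mu : {measure set E -> \bar R}) :
  (separable_space (mclasses mu) <->
     exists F : nat -> set (set E),
       [/\ filtration F, forall n, finite_set (F n) & approximable mu F]) /\
  (compact [set: mclasses mu] <->
     exists F : nat -> set (set E),
       [/\ filtration F, forall n, finite_set (F n) &
           uniformly_approximable mu F]).
Proof.
split; split.
- exact: separable_approximable.
- by move=> [F [fF finF]]; exact: approximable_separable.
- exact: compact_uniformly_approximable.
- by move=> [F [fF finF]]; exact: uniformly_approximable_compact.
Qed.
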